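(* Let $\beta\in \mathrm{Sym}_n(\mathbb Q)$ be positive semi-definite of rank $n-1$, $\ell_j$ a cusp, and $U_{ij}$ one of the finitely many $n$-dimensional subspaces of the form $\mathrm{span}(X)$, $X\in\Omega_{\beta,j}\cap(L^n+h)$. The action of $\Gamma_j$ on $\Omega_{\beta,j}$ induces a free action of $\Gamma_{U_{ij}}\backslash\Gamma_j$ on $\Omega_{\beta,i,j}$, where $\Gamma_{U_{ij}}=N_{U_{ij}}\cap\Gamma_j$ is the subgroup of $\Gamma_j$ acting trivially on $U_{ij}$.
   Context: $V$ is a $\mathbb Q$-vector space of dimension $p+1$ with a non-degenerate symmetric bilinear form $(\,,)$ of signature $(p,1)$; $L\subset V$ is a $\mathbb Z$-lattice of full rank with $L\subset L^{\#}$ (dual lattice); $1\le n\le p$, $h\in(L^{\#})^n$. $G_0(\mathbb R)$ is the identity component of $SO(V)(\mathbb R)$ and $\Gamma$ is a neat subgroup of finite index in the stabilizer of $L$ in $G_0(\mathbb R)$, acting trivially on $L^{\#}/L$; $V$ has nonzero rational isotropic vectors. $\ell_0,\dots,\ell_r$ represent the $\Gamma$-orbits of rational isotropic lines. $N_j$ is the unipotent radical of the parabolic subgroup stabilizing $\ell_j$; it fixes $\ell_j$ pointwise and acts trivially on $\ell_j^\perp/\ell_j$; $\Gamma_j=\Gamma\cap N_j$, and for $U\subset\ell_j^\perp$, $N_U=\{g\in N_j:g|_U=\mathrm{id}\}$. For $X\in V^n$, $(X,X)=((x_i,x_j))$, and $R(X)$ is the radical of $\mathrm{span}(X)$. $\Omega_{\beta,j}=\{X\in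 V^n:\frac12(X,X)=\beta,\ R(X)=\ell_j\}$ and $\Omega_{\beta,i,j}=\{X\in\Omega_{\beta,j}:\mathrm{span}(X)=U_{ij}\}$. *)

(* Defs.v *)
From HB Require Import structures.
From mathcomp Require Import all_boot all_order all_algebra all_field.
From mathcomp Require Import sesquilinear.
From mathcomp Require Import boolp classical_sets functions cardinality.
From mathcomp Require Import reals topology normedtype.
Set Implicit Arguments.
Unset Strict Implicit.
Unset Printing Implicit Defensive.
Import Order.TTheory GRing.Theory Num.Theory.
Import passmx.
Import numFieldNormedType.Exports.
Local Open Scope classical_set_scope.
Local Open Scope ring_scope.

Section Action.
Variables (T S : Type) (mul : T -> T -> T) (one : T).

Definition group_action (G : set T) (Om : set S) (act : T -> S -> S) :=
  [/\ forall g x, G g -> Om x -> Om (act g x),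
      forall x, Om x -> act one x = x
    & forall g h x, G g -> G h -> Om x -> act (mul g h) x = act g (act h x)].

Definition free_action (G : set T) (Om : set S) (act : T -> S -> S) :=
  forall g x, G g -> Om x -> act g x = x -> g = one.

End Action.

Section LinearGroups.
Variable V : vectType rat.
Implicit Types (G H : set 'End(V)) (g : 'End(V)).

Definition subgroup_GL G :=
  [/\ forall g, G g -> lker g = 0%VS,
      G \1%VF,
      forall g h, G g -> G h -> G (g \o h)%VF
    & forall g, G g -> G (g^-1)%VF].

Definition normal_subgroup H G :=
  [/\ subgroup_GL H, H `<=` G
    & forall g h, G g -> H h -> H (g \o h \o g^-1)%VF].

Definition right_coset H g : set 'End(V) := [set (h \o g)%VF | h in H].

(* The set H \ G of cosets H g; for H normal in G it is a group under
   coset_mul, with unit H. *)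
Definition left_quotient H G : set (set 'End(V)) := right_coset H @` G.

Definition coset_mul (C D : set 'End(V)) : set 'End(V) :=
  [set (c \o d)%VF | c in C & d in D].

Definition finite_index_subgroup H G :=
  [/\ subgroup_GL H, H `<=` G & finite_set (left_quotient H G)].

Definition unipotent g := exists k, forall v, iter k (fun x => g x - x) v = 0.

(* The rational points of the unipotent radical of an algebraic group, from its
   group P of rational points. If the algebraic group is connected, then P is
   Zariski dense in it (the base field has characteristic 0), so the Zariski
   closure of a normal unipotent subgroup of P is again normal and unipotent,
   and it is connected. *)
Definition unipotent_radical (P : set 'End(V)) : set 'End(V) :=
  [set g | exists H, [/\ normal_subgroup H P, H `<=` unipotent & H g]].

(* Row i of endo_mx g lists the coordinates of the image of the i-th vector of
   a fixed basis of V: matrices act on row vectors from the right. *)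
Definition endo_mx g : 'M[rat]_(\dim {:V}) :=
  mxof (vbasis {:V}) (vbasis {:V}) g.

Inductive mul_generated (E : set algC) : algC -> Prop :=
| Mulgen1 : mul_generated E 1
| MulgenE z of E z : mul_generated E z
| MulgenM z w of mul_generated E z & mul_generated E w : mul_generated E (z * w)
| MulgenV z of mul_generated E z : mul_generated E z^-1.

Definition eigenvalues g : set algC :=
  [set z | eigenvalue (map_mx ratr (endo_mx g)) z].

Definition neat G := forall g, G g ->
  forall z k, mul_generated (eigenvalues g) z -> (0 < k)%N -> z ^+ k = 1 ->
  z = 1.

End LinearGroups.

Section QuadraticSpace.
Variables (V : vectType rat) (b : {symmetric V}).
Implicit Types (g : 'End(V)) (l U : {vspace V}).

(* Signature (p, 1). *)
Definition lorentzian (p : nat) := exists e : p.+1.-tuple V,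
  [/\ basis_of {:V} e,
      forall i j, i != j -> b (tnth e i) (tnth e j) = 0,
      forall i : 'I_p.+1, (i < p)%N -> 0 < b (tnth e i) (tnth e i)
    & b (tnth e ord_max) (tnth e ord_max) < 0].

Definition is_lattice (L : set V) := exists e : (\dim {:V}).-tuple V,
  basis_of {:V} e /\
  L = [set x | exists z : 'I_(\dim {:V}) -> int,
         x = \sum_i (z i)%:~R *: tnth e i].

Definition dual_lattice (L : set V) : set V :=
  [set x | forall y, L y -> b x y \is a Num.int].

Definition SO : set 'End(V) :=
  [set g : 'End(V) | isometry b b g /\ \det (endo_mx g) = 1].

Definition basis_gram : 'M[rat]_(\dim {:V}) :=
  \matrix_(i, j) b (tnth (vbasis {:V}) i) (tnth (vbasis {:V}) j).

Definition SO_real (R : realType) : set 'M[R]_(\dim {:V}) :=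
  [set A | A *m map_mx ratr basis_gram *m A^T = map_mx ratr basis_gram
           /\ \det A = 1].

Definition G0_real (R : realType) : set 'M[R]_(\dim {:V}) :=
  connected_component (@SO_real R) 1%:M.

(* The stabilizer of L in the identity component of the real points of SO(V).
   As L spans V over the rationals, a real automorphism of V stabilizing L is
   rational (lattice_stabilizer_rational), so the stabilizer is given as a set
   of rational automorphisms. *)
Definition lattice_stabilizer (R : realType) (L : set V) : set 'End(V) :=
  [set g : 'End(V) | @G0_real R (map_mx ratr (endo_mx g)) /\ [set g x | x in L] = L].

Definition real_coords (R : realType) (x : V) : 'rV[R]_(\dim {:V}) :=
  map_mx ratr (rVof (vbasis {:V}) x).

Lemma lattice_stabilizer_rational (R : realType) (L : set V)
    (A : 'M[R]_(\dim {:V})) :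
  is_lattice L ->
  [set real_coords R x *m A | x in L] = real_coords R @` L ->
  exists g, map_mx ratr (endo_mx g) = A.
Proof.
move=> [e [be LE]] stabA; pose bV := vbasisP {:V}.
have /choice [f fP] i : exists y, real_coords R (tnth e i) *m A = real_coords R y.
  have : [set real_coords R x *m A | x in L] (real_coords R (tnth e i) *m A).
    exists (tnth e i) => //; rewrite LE; exists (fun k => (k == i)%:Z).
    rewrite (bigD1 i) //= eqxx scale1r big1 ?addr0 // => k /negPf ->.
    by rewrite scale0r.
  by rewrite stabA => -[y _ <-]; exists y.
pose E : 'M[rat]_(\dim {:V}) := \matrix_i rVof (vbasis {:V}) (tnth e i).
pose F : 'M[rat]_(\dim {:V}) := \matrix_i rVof (vbasis {:V}) (f i).
have EA : map_mx ratr E *m A = map_mx ratr F.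
  apply/row_matrixP => i; rewrite row_mul -!map_row !rowK; exact: fP.
have Eu : E \in unitmx.
  rewrite -row_free_unit; apply/row_freeP.
  exists (\matrix_i rVof e (tnth (vbasis {:V}) i)).
  apply/row_matrixP => i; rewrite row_mul rowK row1.
  rewrite -(rVofE be) -tnth_nth -[X in rVof e X](rVofK bV).
  set u := rVof _ _; apply: (canRL (vecofK be)).
  by rewrite mulmx_sum_row !linear_sum /=; apply: eq_bigr => k _;
     rewrite rowK linearZ /= rVofK // (tnth_nth 0).
exists (hommx (vbasis {:V}) (vbasis {:V}) (invmx E *m F)).
rewrite /endo_mx hommxK // map_mxM -EA mulmxA -map_mxM mulVmx //.
by rewrite map_mx1 mul1mx.
Qed.

Definition isotropic_line l :=
  \dim l = 1 /\ {in l, forall x, b x x = 0}.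

Definition cusp_representatives (G : set 'End(V)) (r : nat)
    (l : 'I_r.+1 -> {vspace V}) :=
  [/\ forall j, isotropic_line (l j),
      forall m, isotropic_line m -> exists j g, G g /\ (g @: l j)%VS = m
    & forall j k g, G g -> (g @: l j)%VS = l k -> j = k].

Definition parabolic l : set 'End(V) := [set g : 'End(V) | SO g /\ (g @: l)%VS = l].

Definition cusp_unipotent l : set 'End(V) := unipotent_radical (parabolic l).

Definition unipotent_fixing l U : set 'End(V) :=
  [set g : 'End(V) | cusp_unipotent l g /\ {in U, forall x, g x = x}].

Definition gram (n : nat) (X : n.-tuple V) : 'M[rat]_n :=
  \matrix_(i, j) b (tnth X i) (tnth X j).

Definition radical (n : nat) (X : n.-tuple V) : {vspace V} :=
  (<<X>> :&: orthov b <<X>>)%VS.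

Definition Omega (n : nat) (beta : 'M[rat]_n) l : set (n.-tuple V) :=
  [set X | 2^-1 *: gram X = beta /\ radical X = l].

Definition Omega_span (n : nat) (beta : 'M[rat]_n) l U : set (n.-tuple V) :=
  [set X | Omega beta l X /\ <<X>>%VS = U].

Definition lattice_coset (L : set V) (n : nat) (h : n.-tuple V) :
    set (n.-tuple V) :=
  [set X | forall i, L (tnth X i - tnth h i)].

Definition cusp_spans (L : set V) (n : nat) (h : n.-tuple V)
    (beta : 'M[rat]_n) l : set {vspace V} :=
  [set <<X>>%VS | X in Omega beta l `&` lattice_coset L h].

End QuadraticSpace.

Definition tuple_act (V : vectType rat) (n : nat) (g : 'End(V))
  (X : n.-tuple V) : n.-tuple V := map_tuple g X.

Definition pos_semidef (n : nat) (beta : 'M[rat]_n) :=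
  beta^T = beta /\ forall v : 'rV[rat]_n, 0 <= (v *m beta *m v^T) 0 0.

(* Main.v *)
Require Import Defs.
From mathcomp Require Import all_boot all_order all_algebra sesquilinear.
From mathcomp Require Import boolp classical_sets cardinality reals.
From mathcomp Require Import ring.
Import Order.TTheory GRing.Theory Num.Theory passmx.
Local Open Scope classical_set_scope.
Local Open Scope ring_scope.

Set Implicit Arguments.
Unset Strict Implicit.
Unset Printing Implicit Defensive.

(** The quotient of the orthogonal of an isotropic line [l] by [l] is positive
    definite, so a unipotent isometry stabilizing [l] acts trivially on it (and on
    [l]). Hence the unipotent radical of the stabilizer of [l] is the group of
    isometries acting trivially on both, and it moves vectors of the orthogonal of
    [l] only by elements of [l], so it preserves every subspace between [l] and its
    orthogonal. The stabilizer of a tuple spanning [U] is then the pointwise fixer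
    of [U], whence the freeness. The rank of [beta] forces the [X i] to be linearly
    independent, and there are finitely many spans because the [X i] project to
    dual lattice vectors of bounded norm in the positive definite quotient. *)

(** * Quotient of a group by the pointwise fixer of a subspace, acting on spanning tuples *)

Section FixingAction.
Variables (V : vectType rat) (G : set 'End(V)) (U : {vspace V}).
Hypothesis G_group : subgroup_GL G.
Hypothesis G_stab : forall g x, G g -> x \in U -> g x \in U.

Let K : set 'End(V) := [set g | G g /\ {in U, forall x, g x = x}].

Lemma subgroup_GL_invK g : G g -> cancel g (g^-1)%VF.
Proof. by case: G_group => G_inj _ _ _ /G_inj/eqP; apply: lker0_lfunK. Qed.

Lemma subgroup_GL_Kinv g : G g -> cancel (g^-1)%VF g.
Proof. by case: G_group => G_inj _ _ _ /G_inj/eqP; apply: lker0_lfunVK. Qed.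

Lemma normal_fixing : normal_subgroup K G.
Proof.
have [G_inj G1 GM GV] := G_group; split; [|by move=> g []|]; last first.
- move=> g h Gg [Gh hU]; split.
    by apply: (GM _ _ (GM _ _ Gg Gh)); exact: GV.
  move=> x xU; rewrite !comp_lfunE /= hU ?subgroup_GL_Kinv //.
  by apply: G_stab => //; apply: GV.
split; first by move=> g [/G_inj].
- by split=> // x _; rewrite id_lfunE.
- move=> g h [Gg gU] [Gh hU]; split; first exact: GM.
  by move=> x xU; rewrite comp_lfunE hU ?gU.
- move=> g [Gg gU]; split; first exact: GV.
  by move=> x xU; rewrite -{1}(gU x xU) subgroup_GL_invK.
Qed.

(** [K] is the kernel of restriction to [U], so a coset amounts to a restriction: products and
    equality of cosets can be checked on [U]. *)
Lemma right_coset_fixing g : G g ->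
  right_coset K g = [set f | G f /\ {in U, f =1 g}].
Proof.
have [G_inj G1 GM GV] := G_group.
move=> Gg; apply/seteqP; split=> [_ [k [Gk kU] <-]|f [Gf fg]].
  by split=> [|x xU]; [exact: GM|rewrite comp_lfunE kU ?G_stab].
exists (f \o g^-1)%VF.
  split=> [|x xU]; first by apply: (GM) => //; exact: GV.
  by rewrite comp_lfunE fg ?subgroup_GL_Kinv ?G_stab //; exact: GV.
by apply/lfunP => x; rewrite !comp_lfunE /= subgroup_GL_invK.
Qed.

Lemma coset_mul_fixing g h : G g -> G h ->
  coset_mul (right_coset K g) (right_coset K h) = right_coset K (g \o h)%VF.
Proof.
have [G_inj G1 GM GV] := G_group.
move=> Gg Gh; rewrite !right_coset_fixing //; last exact: GM.
apply/seteqP; split=> [_ [c [Gc cg] [d [Gd dh] <-]]|f [Gf fgh]].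
  split=> [|x xU]; first exact: GM.
  by rewrite !comp_lfunE dh // cg // G_stab.
exists (f \o h^-1)%VF.
  split=> [|x xU]; first by apply: (GM) => //; exact: GV.
  have hxU : (h^-1)%VF x \in U by apply: G_stab => //; exact: GV.
  by rewrite comp_lfunE /= fgh // comp_lfunE subgroup_GL_Kinv.
exists h; first by split.
by apply/lfunP => x; rewrite !comp_lfunE /= subgroup_GL_invK.
Qed.

Lemma right_coset_fixing1 : right_coset K \1%VF = K.
Proof.
have [G_inj G1 GM GV] := G_group.
rewrite right_coset_fixing //; apply/seteqP.
by split=> f [Gf fU]; split=> // x xU; rewrite fU ?id_lfunE.
Qed.

Variables (n : nat) (Om : set (n.-tuple V)).
Hypothesis Om_span : forall X, Om X -> <<X>>%VS = U.
Hypothesis Om_stab : forall g X, G g -> Om X -> Om (tuple_act g X).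

Lemma eq_tuple_act (f g : 'End(V)) X :
  Om X -> {in U, f =1 g} -> tuple_act f X = tuple_act g X.
Proof.
move=> /Om_span XU fg; apply: val_inj => /=.
by apply/eq_in_map => x /memv_span; rewrite XU => /fg.
Qed.

Lemma tuple_act1 (X : n.-tuple V) : tuple_act \1%VF X = X.
Proof. by apply: val_inj => /=; apply: map_id_in => x _; rewrite id_lfunE. Qed.

Lemma tuple_actM (g h : 'End(V)) (X : n.-tuple V) :
  tuple_act (g \o h)%VF X = tuple_act g (tuple_act h X).
Proof.
apply: val_inj => /=; rewrite -map_comp.
by apply: eq_map => x; rewrite comp_lfunE.
Qed.

Lemma fixing_quotient_action : exists act : set 'End(V) -> n.-tuple V -> n.-tuple V,
  [/\ forall g X, G g -> Om X -> act (right_coset K g) X = tuple_act g X,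
      group_action (@coset_mul V) K (left_quotient K G) Om act
    & free_action K (left_quotient K G) Om act].
Proof.
have [G_inj G1 GM GV] := G_group.
(* A coset acts through a chosen element; the choice is immaterial because the entries of a tuple in
   [Om] lie in [U]. The default [\1] only serves empty sets, which are not cosets. *)
pose act C X := @tuple_act V n (xget \1%VF C) X.
have actE g X : G g -> Om X -> act (right_coset K g) X = tuple_act g X.
  move=> Gg OX; apply: eq_tuple_act => //.
  suff [] : right_coset K g (xget \1%VF (right_coset K g)).
    by move=> k [_ kU] <- x xU; rewrite comp_lfunE kU ?G_stab.
  apply: xgetPex; exists g; rewrite right_coset_fixing //.
exists act; split=> //.
- split.
  + by move=> _ X [g Gg <-] OX; rewrite actE //; exact: Om_stab.
  + by move=> X OX; rewrite -right_coset_fixing1 actE // tuple_act1.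
  + move=> _ _ X [g Gg <-] [h Gh <-] OX.
    rewrite coset_mul_fixing // !actE ?tuple_actM //; first exact: Om_stab.
    exact: GM.
- move=> _ X [g Gg <-] OX; rewrite actE // => gX.
  rewrite -[RHS]right_coset_fixing1 !right_coset_fixing //.
  have gU : {in U, forall x, g x = x}.
    move=> x; rewrite -(Om_span OX) => /coord_span ->.
    rewrite linear_sum; apply: eq_bigr => i _; rewrite linearZ /=.
    congr (_ *: _); rewrite -[RHS](congr1 (fun Y : n.-tuple V => Y`_i) gX) /=.
    by rewrite (nth_map 0) // size_tuple.
  by apply/seteqP; split=> f [Gf fU]; split=> // x xU;
     rewrite fU // gU // id_lfunE.
Qed.

End FixingAction.

(** * Positivity on the orthogonal of an isotropic line *)

Section LorentzianSpace.
Variables (V : vectType rat) (b : {symmetric V}).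
Implicit Types (g : 'End(V)) (l U : {vspace V}) (x y z : V).

Lemma symmC x y : b x y = b y x.
Proof. by rewrite hermC expr0 mul1r. Qed.

(** The form [f] is the coordinate along the negative vector of the orthogonal basis; on its kernel
    only the positive squares remain. *)
Lemma lorentzian_hyperplane p : lorentzian b p -> exists f : {scalar V},
  forall z, f z = 0 -> z != 0 -> 0 < b z z.
Proof.
move=> [e [be orth pos _]]; exists (coord e ord_max) => z z0 zN0.
have zE := coord_basis be (memvf z).
have bzz : b z z = \sum_i coord e i z ^+ 2 * b e`_i e`_i.
  rewrite [X in b X _]zE linear_sumlz; apply: eq_bigr => i _.
  rewrite [X in b _ X = _]zE linear_sumr (bigD1 i) //= big1 => [|k ki].
    by rewrite addr0 linearZl_LR linearZr_LR /= mulrA -expr2.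
  by rewrite linearZl_LR linearZr_LR /= -!tnth_nth orth ?mulr0 // eq_sym.
have term_ge0 i : true -> 0 <= coord e i z ^+ 2 * b e`_i e`_i.
  move=> _; have [ip|] := ltnP i p.
    by rewrite mulr_ge0 ?sqr_ge0 // -!tnth_nth ltW ?pos.
  move=> pi; suff -> : i = ord_max by rewrite z0 expr0n mul0r.
  by apply/val_inj/eqP; rewrite eqn_leq /= pi -ltnS ltn_ord.
rewrite lt_def {2}bzz sumr_ge0 // andbT; apply: contra zN0 => /eqP bz0.
rewrite zE big1 // => i _; have [ip|pi] := ltnP i p; last first.
  suff -> : i = ord_max by rewrite z0 scale0r.
  by apply/val_inj/eqP; rewrite eqn_leq /= pi -ltnS ltn_ord.
have /(psumr_eq0P term_ge0) /(_ i isT)/eqP :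
  \sum_i coord e i z ^+ 2 * b e`_i e`_i = 0 by rewrite -bzz.
rewrite mulf_eq0 expf_eq0 /= -!tnth_nth (gt_eqF (pos _ ip)) orbF => /eqP ->.
by rewrite scale0r.
Qed.

Variables (p : nat) (l : {vspace V}).
Hypothesis b_sign : lorentzian b p.
Hypothesis l_iso : isotropic_line b l.

Lemma isotropic_line_gen : exists2 x, x != 0 & l = <[x]>%VS.
Proof.
case: l_iso => dl _; exists (vpick l); first by rewrite vpick0 -dimv_eq0 dl.
apply/eqP; rewrite eq_sym eqEdim -memvE memv_pick dl dim_vline.
by rewrite vpick0 -dimv_eq0 dl.
Qed.

(* Subtracting a multiple of the isotropic generator moves [y] into a positive
   definite hyperplane without changing its norm. *)
Lemma isotropic_perp_ge0 y :
  y \in orthov b l -> 0 <= b y y ?= iff (y \in l).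
Proof.
have [f fpos] := lorentzian_hyperplane b_sign.
have [x xN0 lE] := isotropic_line_gen; case: l_iso => _ iso.
have bx0 : b x x = 0 by apply: iso; rewrite lE memv_line.
have fx : f x != 0.
  by apply/eqP => /fpos/(_ xN0); rewrite bx0 ltxx.
rewrite lE mem_orthov1 => /eqP yx; pose z := y - (f y / f x) *: x.
have fz : f z = 0 by rewrite /z linearB linearZ /= divfK ?subrr.
have bz : b z z = b y y.
  rewrite /z linearBl linearBr linearBr !linearZl_LR !linearZr_LR /=.
  by rewrite (symmC x y) yx bx0 !mulr0 !subr0.
split.
  rewrite -bz; have [->|zN0] := eqVneq z 0; first by rewrite linear0l.
  by rewrite ltW ?fpos.
apply/eqP/idP => [byy|/vlineP[k ->]]; last first.
  by rewrite linearZl_LR linearZr_LR /= bx0 !mulr0.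
have : z == 0 by apply/negPn/negP => /(fpos _ fz); rewrite bz -byy ltxx.
by rewrite subr_eq0 => /eqP ->; rewrite memvZ ?memv_line.
Qed.

Lemma isotropic_perp_eq0 y : y \in orthov b l -> b y y = 0 -> y \in l.
Proof. by move=> /isotropic_perp_ge0[_ <-] ->. Qed.

(** The form is only semidefinite here. A null [z] lies in [l] and so pairs to 0 with [y]; otherwise
    nonnegativity at [b z z *: y - b y z *: z] gives the inequality multiplied by [b z z]. *)
Lemma isotropic_perp_CauchySchwarz y z : y \in orthov b l -> z \in orthov b l ->
  b y z ^+ 2 <= b y y * b z z.
Proof.
move=> yl zl.
have pos v : v \in orthov b l -> 0 <= b v v by case/isotropic_perp_ge0.
have [z0|zN0] := eqVneq (b z z) 0.
  have /mem_orthovP -> // : y \in orthov b l by [].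
    by rewrite z0 mulr0 expr0n.
  exact: isotropic_perp_eq0.
have zgt0 : 0 < b z z by rewrite lt_def zN0 pos.
have := pos (b z z *: y - b y z *: z) (memvB (memvZ _ yl) (memvZ _ zl)).
rewrite linearBl !linearBr !linearZl_LR !linearZr_LR /= (symmC z y).
have -> : b z z * (b z z * b y y) - b z z * (b y z * b y z)
  - (b y z * (b z z * b y z) - b y z * (b y z * b z z))
  = b z z * (b y y * b z z - b y z ^+ 2) by ring.
by rewrite pmulr_rge0 // subr_ge0.
Qed.

End LorentzianSpace.

(** * The unipotent radical of the stabilizer of an isotropic line *)

Section CuspUnipotent.
Variables (V : vectType rat) (b : {symmetric V}).
Hypothesis b_nondeg : nondegenerate b.
Implicit Types (g h : 'End(V)) (l U : {vspace V}) (x y z : V).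

Lemma isometry_lker0 g : isometry b b g -> lker g = 0%VS.
Proof.
move=> iso_g; apply/eqP; rewrite -subv0; apply/subvP => x.
rewrite memv_ker -(eqP b_nondeg) => /eqP gx0.
by apply/mem_orthovP => y _; rewrite -iso_g gx0 linear0l.
Qed.

Lemma endo_mxM g h : endo_mx (g \o h)%VF = endo_mx h *m endo_mx g.
Proof. exact: mxof_comp (vbasisP _) _ _. Qed.

Lemma SO_subgroup : subgroup_GL (SO b).
Proof.
split.
- by move=> g [/isometry_lker0].
- split; first by move=> x y; rewrite !id_lfunE.
  by rewrite /endo_mx mxof1 ?det1 ?(basis_free (vbasisP _)).
- move=> g h [ig dg] [ih dh]; split; last by rewrite endo_mxM det_mulmx dg dh mulr1.
  by move=> x y; rewrite !comp_lfunE ig ih.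
- move=> g [ig dg]; have /eqP g0 := isometry_lker0 ig; split.
    by move=> x y; rewrite -ig !lker0_lfunVK.
  have := endo_mxM g (g^-1)%VF; rewrite lker0_compfV //.
  rewrite /endo_mx mxof1 ?(basis_free (vbasisP _)) // => /(congr1 determinant).
  by rewrite det1 det_mulmx dg mulr1.
Qed.

Lemma isometry_orthov g U x : isometry b b g ->
  (g @: U)%VS = U -> x \in orthov b U -> g x \in orthov b U.
Proof.
move=> ig gU /mem_orthovP xU; apply/mem_orthovP => y.
by rewrite -gU => /memv_imgP[u /xU xu0 ->]; rewrite ig.
Qed.

Variables (p : nat) (l : {vspace V}).
Hypothesis b_sign : lorentzian b p.
Hypothesis l_iso : isotropic_line b l.

(* On the positive definite quotient of the orthogonal of [l] by [l], an
   isometry [g] with [(g - 1)^2 y = 0] satisfies [(g - 1) y = 0]: expand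
   [b (g y) (g z) = b y z] for [z = g y - y]. *)
Lemma unipotent_isometry_perp g y : isometry b b g -> (g @: l)%VS = l ->
  unipotent g -> y \in orthov b l -> g y - y \in l.
Proof.
move=> ig gl [k /(_ y) gk0] yl.
have step z : z \in orthov b l -> g (g z - z) - (g z - z) \in l -> g z - z \in l.
  move=> zl; set w := g z - z => gw.
  have wl : w \in orthov b l by rewrite memvB // isometry_orthov.
  apply: (isotropic_perp_eq0 b_sign l_iso) => //.
  have wd u : u \in orthov b l -> b u (g w - w) = 0.
    by move=> /mem_orthovP; apply.
  have := ig z w; rewrite -[g z](subrK z) -/w.
  rewrite -[g w](subrK w); move: (g w - w) wd => d wd.
  rewrite linearDl !linearDr /= !wd // !add0r.
  by move/(canRL (addrK _)); rewrite subrr.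
(* With one extra iterate, the base case of the induction is the goal itself; [step] then removes
   one factor [g - 1] at a time. *)
have {gk0} : iter k.+1 (fun x => g x - x) y \in l.
  by rewrite iterS gk0 linear0 subrr mem0v.
elim: k y yl => [//|k IHk] y yl; rewrite iterSr => /IHk gyk.
by apply: step => //; apply: gyk; rewrite memvB // isometry_orthov.
Qed.

(** On a line [g] is a scalar [c], and unipotence makes [c - 1] nilpotent, hence 0. *)
Lemma unipotent_fix_line g x :
  (g @: l)%VS = l -> unipotent g -> x \in l -> g x = x.
Proof.
move=> gl [k gk0]; have [e eN0 lE] := isotropic_line_gen l_iso.
have /vlineP[c ge] : g e \in <[e]>%VS.
  by rewrite -lE -gl memv_img // lE memv_line.
have : iter k (fun x => g x - x) e = (c - 1) ^+ k *: e.
  elim: {gk0}k => [|k IHk]; first by rewrite expr0 scale1r.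
  by rewrite iterS IHk linearZ /= ge exprSr !scalerA -scalerBl mulrBr mulr1.
rewrite gk0 => /esym/eqP; rewrite scaler_eq0 (negPf eN0) orbF expf_eq0.
rewrite subr_eq0 => /andP[_ /eqP c1]; rewrite lE => /vlineP[a ->].
by rewrite linearZ /= ge c1 scale1r.
Qed.

Definition line_unipotent : set 'End(V) :=
  [set g | [/\ SO b g, {in l, forall x, g x = x}
             & {in orthov b l, forall x, g x - x \in l}]].

Lemma limg_fixed g U : {in U, forall x, g x = x} -> (g @: U)%VS = U.
Proof.
move=> gU; apply/vspaceP => x; apply/memv_imgP/idP => [[u ul ->]|xl].
  by rewrite gU.
by exists x; rewrite ?gU.
Qed.

Lemma line_unipotent_subgroup : subgroup_GL line_unipotent.
Proof.
have [SO_inj SO1 SOM SOV] := SO_subgroup; split.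
- by move=> f [/SO_inj].
- by split=> // x _; rewrite id_lfunE ?subrr ?mem0v.
- move=> f h [SOf fl fp] [SOh hl hp]; split; first exact: SOM.
    by move=> x xl; rewrite comp_lfunE hl ?fl.
  move=> x xl; rewrite comp_lfunE /=.
  rewrite -[h x](subrK x) linearD /= fl ?hp // -addrA.
  by rewrite memvD ?hp ?fp.
- move=> f [SOf fl fp]; have fVl : {in l, forall x, (f^-1)%VF x = x}.
    by move=> x xl; rewrite -{1}(fl x xl) (subgroup_GL_invK SO_subgroup).
  split=> //; first exact: SOV.
  move=> x xl; have fVx : (f^-1)%VF x \in orthov b l.
    by apply: isometry_orthov; [case: (SOV _ SOf)|exact: limg_fixed|].
  by rewrite -memvN opprB -{1}(subgroup_GL_Kinv SO_subgroup SOf x) fp.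
Qed.

Lemma line_unipotent_normal : normal_subgroup line_unipotent (parabolic b l).
Proof.
have [SO_inj SO1 SOM SOV] := SO_subgroup.
split; first exact: line_unipotent_subgroup.
  by move=> f [SOf fl _]; split=> //; exact: limg_fixed.
move=> f h [SOf fl] [SOh hl hp].
have fVl : ((f^-1)%VF @: l)%VS = l.
  by rewrite -{1}fl -limg_comp lker0_compVf ?lim1g //; apply/eqP/SO_inj.
split; first by apply: (SOM _ _ (SOM _ _ SOf SOh)); exact: SOV.
  move=> x xl; rewrite !comp_lfunE /= hl ?(subgroup_GL_Kinv SO_subgroup) //.
  by rewrite -fVl memv_img.
move=> x xl; rewrite !comp_lfunE /=; set y := (f^-1)%VF x.
have yl : y \in orthov b l.
  by apply: isometry_orthov; [case: (SOV _ SOf)|exact: fVl|].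
by rewrite -(subgroup_GL_Kinv SO_subgroup SOf x) -/y -linearB -fl memv_img ?hp.
Qed.

(** Fixing [l] forces, by duality, trivial action on the quotient of [V] by the orthogonal of [l].
    So [g - 1] descends the flag from [V] to the orthogonal, to [l], to 0, in three steps. *)
Lemma line_unipotent_sub : line_unipotent `<=` @unipotent V.
Proof.
move=> f [[isof df] fl fp]; exists 3%N => v /=.
have fv : f v - v \in orthov b l.
  apply/mem_orthovP => x xl; rewrite linearBl /=.
  by rewrite -[X in b (f v) X](fl x xl) isof subrr.
by rewrite fl ?subrr // fp.
Qed.

(** Unipotent elements of the parabolic act trivially on both pieces, and [line_unipotent] is itself
    normal and unipotent, so it is the largest such subgroup. *)
Lemma cusp_unipotentE : cusp_unipotent b l = line_unipotent.
Proof.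
apply/seteqP; split=> [g [H [[_ HP _] Hu Hg]]|g Ng].
  have [[SOg dg] gl] := HP _ Hg; split=> // x xl.
    by apply: (unipotent_fix_line gl) => //; exact: Hu.
  by apply: unipotent_isometry_perp => //; exact: Hu.
exists line_unipotent; split=> //; first exact: line_unipotent_normal.
exact: line_unipotent_sub.
Qed.

End CuspUnipotent.

(** * Spans of tuples with radical [l]: dimension and finiteness *)

Lemma lattice_multiple (V : vectType rat) (L : set V) (w : V) : is_lattice L ->
  exists2 m : int, m != 0 & L (m%:~R *: w).
Proof.
move=> [e [be ->]]; pose c i := coord e i w.
(* A common denominator of the coordinates of [w] in the lattice basis. *)
exists (\prod_i denq (c i)).
  by apply/prodf_neq0 => i _; apply: denq_neq0.
exists (fun i => numq (c i) * \prod_(k | k != i) denq (c k)).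
rewrite {1}(coord_basis be (memvf w)) scaler_sumr; apply: eq_bigr => i _.
rewrite scalerA -tnth_nth (bigD1 i) //= !intrM; congr (_ *: _).
have /eqP := divq_num_den (c i).
rewrite eq_sym -(inj_eq (mulIf (_ : (denq (c i))%:~R != 0))) ?divfK ?intr_eq0 ?denq_eq0 //.
move=> /eqP <-; rewrite -/(c i); ring.
Qed.

Section CuspSpans.
Variables (V : vectType rat) (b : {symmetric V}).
Variables (n : nat) (beta : 'M[rat]_n) (l : {vspace V}).
Implicit Types (X Y : n.-tuple V) (U : {vspace V}).

Lemma Omega_sub_span X : Omega b beta l X -> (l <= <<X>>)%VS.
Proof. by case=> _ <-; apply: capvSl. Qed.

Lemma Omega_span_perp X : Omega b beta l X -> (<<X>> <= orthov b l)%VS.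
Proof. by case=> _ <-; rewrite orthov_sym capvSr. Qed.

(** The Gram matrix has a one-dimensional kernel, spanned by the coefficients [c] of a nonzero
    radical vector [x]. A linear relation among the entries of [X] also lies in it, so it is [a]
    times [c]; evaluating gives [a *: x = 0], hence [a = 0]. *)
Lemma Omega_dim_span X : Omega b beta l X ->
  \dim l = 1%N -> \rank beta = n.-1 -> (0 < n)%N -> \dim <<X>>%VS = n.
Proof.
move=> [gramX radX] dl rk n_gt0.
suff : free X by move/eqP ->; rewrite size_tuple.
have rkG : \rank (gram b X) = n.-1.
  by rewrite -rk -gramX (eqmx_scale _ (_ : 2^-1 != 0)).
have kerG (c : 'I_n -> rat) :
    {in <<X>>%VS, forall y, b (\sum_i c i *: X`_i) y = 0} ->
    (\row_i c i <= kermx (gram b X))%MS.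
  move=> c0; apply/sub_kermxP/rowP => k; rewrite !mxE.
  rewrite -[RHS](c0 (tnth X k)) ?memv_span ?mem_tnth //.
  rewrite linear_sumlz; apply: eq_bigr => i _.
  by rewrite !mxE linearZl_LR /= (tnth_nth 0).
have [x xN0 xl] : exists2 x, x != 0 & x \in radical b X.
  by exists (vpick l); rewrite ?radX ?memv_pick // vpick0 -dimv_eq0 dl.
move: xl; rewrite memv_cap => /andP[/coord_span xE /mem_orthovP xO].
pose c i := coord X i x; have {}xE : x = \sum_i c i *: X`_i by [].
clearbody c.
have cK : (\row_i c i <= kermx (gram b X))%MS by apply: kerG; rewrite -xE.
have cN0 : \row_i c i != 0.
  apply: contraNneq xN0 => /rowP c0; rewrite xE big1 // => i _.
  by have := c0 i; rewrite !mxE => ->; rewrite scale0r.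
have kerc : (kermx (gram b X) <= \row_i c i)%MS.
  rewrite -(geq_leqif (mxrank_leqif_sup cK)) rank_rV cN0 mxrank_ker rkG.
  by rewrite -subn1 subKn.
apply/freeP => k k0 i.
have /submx_trans/(_ kerc)/sub_rVP[a /rowP ka] : (\row_i k i <= kermx (gram b X))%MS.
  by apply: kerG => y _; rewrite k0 linear0l.
have {}ka m : k m = a * c m by have := ka m; rewrite !mxE.
have /eqP : a *: x = 0.
  rewrite -k0 xE scaler_sumr; apply: eq_bigr => m _.
  by rewrite scalerA -ka.
by rewrite scaler_eq0 (negPf xN0) orbF => /eqP a0; rewrite ka a0 mul0r.
Qed.

Lemma tuple_act_Omega (g : 'End(V)) X : isometry b b g -> (g @: l)%VS = l ->
  Omega b beta l X -> Omega b beta l (tuple_act g X).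
Proof.
move=> ig gl [gramX radX]; split.
  rewrite -gramX; congr (_ *: _); apply/matrixP => i k.
  by rewrite !mxE !tnth_map ig.
rewrite -gl -radX /radical -limg_span; apply/vspaceP => x.
rewrite memv_cap; apply/andP/memv_imgP => [[/memv_imgP[u uX ->] gu]|[u]].
  exists u => //; rewrite memv_cap uX; apply/mem_orthovP => y yX.
  by rewrite -ig; apply: (mem_orthovP gu); exact: memv_img.
rewrite memv_cap => /andP[uX /mem_orthovP uO] ->.
split; first exact: memv_img.
by apply/mem_orthovP => _ /memv_imgP[y yX ->]; rewrite ig uO.
Qed.

Variables (p : nat) (L : set V) (h : n.-tuple V).
Hypothesis b_sign : lorentzian b p.
Hypothesis l_iso : isotropic_line b l.
Hypothesis L_lattice : is_lattice L.

(** A basis of the orthogonal of [l], scaled into [L] by nonzero integers so that dual lattice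
    vectors pair integrally with it. *)
Lemma lattice_perp_frame : exists w : 'I_(\dim (orthov b l)) -> V,
  [/\ forall k, L (w k), forall k, w k \in orthov b l
    & forall y, (forall k, b y (w k) = 0) -> {in orthov b l, forall z, b y z = 0}].
Proof.
pose e := vbasis (orthov b l).
have /choice[m mP] k : exists m : int, m != 0 /\ L (m%:~R *: e`_k).
  by have [m] := lattice_multiple e`_k L_lattice; exists m.
exists (fun k => (m k)%:~R *: e`_k); split=> [k|k|y y0 z /coord_vbasis ->].
- by case: (mP k).
- by rewrite memvZ // vbasis_mem // mem_nth // size_tuple.
- rewrite linear_sumr big1 // => k _; rewrite linearZr_LR /=.
  have /eqP := y0 k; rewrite linearZr_LR /= mulf_eq0 intr_eq0.
  by case: (mP k) => /negPf -> _ /= /eqP ->; rewrite mulr0.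
Qed.

Hypothesis L_dual : L `<=` dual_lattice b L.
Hypothesis h_dual : forall i, dual_lattice b L (tnth h i).

Lemma lattice_coset_dual X i : lattice_coset L h X -> dual_lattice b L (tnth X i).
Proof.
move=> /(_ i)/L_dual Xh y Ly; rewrite -[tnth X i](subrK (tnth h i)).
by rewrite linearDl rpredD ?Xh ?h_dual.
Qed.

(* The integers [b X_i w_k], for [w] a frame of the orthogonal of [l] inside
   [L], determine [X] modulo [l], hence its span; the Cauchy-Schwarz inequality
   bounds them in terms of [beta]. *)
Lemma finite_cusp_spans : finite_set (cusp_spans b L h beta l).
Proof.
have [w [Lw wl w_ker]] := lattice_perp_frame.
pose bnd (ik : 'I_n * 'I_(\dim (orthov b l))) :=
  Num.bound (2 * beta ik.1 ik.1 * b (w ik.2) (w ik.2)).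
pose B := \max_ik bnd ik.
(* Each bounded integer is stored as absolute value and sign, which makes the codes a finite
   type. *)
pose codeT := {ffun 'I_n * 'I_(\dim (orthov b l)) -> 'I_B.+1 * bool}.
pose coded (X : n.-tuple V) (phi : codeT) := forall ik,
  b (tnth X ik.1) (w ik.2) = (-1) ^+ (phi ik).2 * (phi ik).1%:R.
pose S := Omega b beta l `&` lattice_coset L h.
have codedP X : S X -> exists phi, coded X phi.
  move=> [OX cX].
  have /choice[phi phiP] ik : exists c : 'I_B.+1 * bool,
      b (tnth X ik.1) (w ik.2) = (-1) ^+ c.2 * c.1%:R.
    have /intrP[z zE] := lattice_coset_dual ik.1 cX (Lw ik.2).
    have Xl : tnth X ik.1 \in orthov b l.
      by apply: (subvP (Omega_span_perp OX)); rewrite memv_span ?mem_tnth.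
    have := isotropic_perp_CauchySchwarz b_sign l_iso Xl (wl ik.2).
    have -> : b (tnth X ik.1) (tnth X ik.1) = 2 * beta ik.1 ik.1.
      by case: OX => <- _; rewrite !mxE mulrA divff // mul1r.
    rewrite zE => CS.
    (* Integers satisfy [|z| <= z^2], so the bound on the square bounds [z] itself. *)
    have zB : (`|z| < B.+1)%N.
      rewrite ltnS (leq_trans _ (leq_bigmax ik)) // -(ler_nat rat).
      have c_ge0 : 0 <= 2 * beta ik.1 ik.1 * b (w ik.2) (w ik.2).
        by apply: le_trans CS; rewrite sqr_ge0.
      apply: le_trans (ltW (archi_boundP c_ge0)); apply: le_trans CS.
      rewrite -rmorphXn /= natr_absz ler_int -(real_normK (num_real z)).
      have [->|zN0] := eqVneq z 0; first by rewrite normr0.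
      by rewrite ler_eXnr // -gtz0_ge1 normr_gt0.
    exists (Ordinal zB, z < 0); rewrite /= {1}[z]intEsign.
    by rewrite rmorphM rmorphXn /= rmorphN1 -pmulrn.
  by exists [ffun ik => phi ik] => ik; rewrite ffunE.
have span_sub X Y phi : S X -> S Y -> coded X phi -> coded Y phi ->
    (<<X>> <= <<Y>>)%VS.
  move=> [OX _] [OY _] Xphi Yphi; apply/span_subvP => _ /tnthP[i ->].
  rewrite -[tnth X i](subrK (tnth Y i)).
  apply: memvD; last by rewrite memv_span ?mem_tnth.
  apply: (subvP (Omega_sub_span OY)).
  have dl : tnth X i - tnth Y i \in orthov b l.
    apply: memvB; [apply: (subvP (Omega_span_perp OX))
                  |apply: (subvP (Omega_span_perp OY))];
      by rewrite memv_span ?mem_tnth.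
  (* The difference pairs to 0 with the frame, hence with the whole orthogonal of [l] and with
     itself: it is null, so it lies in [l]. *)
  apply: (isotropic_perp_eq0 b_sign l_iso) => //; apply: w_ker => // k.
  by rewrite linearBl /= (Xphi (i, k)) (Yphi (i, k)) subrr.
(* One tuple is chosen per code; [h] is the dummy value for codes that no tuple realizes. *)
pose F (phi : codeT) := <<xget h [set X | S X /\ coded X phi]>>%VS.
apply: sub_finite_set (finite_image F (@finite_finset _ setT)).
move=> _ [X SX <-]; have [phi Xphi] := codedP X SX.
exists phi => //; rewrite /F.
have [SY Yphi] : [set X | S X /\ coded X phi] (xget h [set X | S X /\ coded X phi]).
  by apply: xgetPex; exists X.
by apply/eqP; rewrite eqEsubv (span_sub _ _ phi) ?(span_sub X _ phi).
Qed.

End CuspSpans.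

(** * Assembly for the group attached to a cusp *)

Lemma subgroup_GLI (V : vectType rat) (G H : set 'End(V)) :
  subgroup_GL G -> subgroup_GL H -> subgroup_GL (G `&` H).
Proof.
move=> [G_inj G1 GM GV] [_ H1 HM HV]; split=> //.
- by move=> g [/G_inj].
- by move=> g h [Gg Hg] [Gh Hh]; split; [exact: GM|exact: HM].
- by move=> g [Gg Hg]; split; [exact: GV|exact: HV].
Qed.

Theorem lemma3p3
  (R : realType) (p : nat) (V : vectType rat) (dimV : \dim {:V} = p.+1)
  (b : {symmetric V}) (b_nondeg : nondegenerate b) (b_sign : lorentzian b p)
  (L : set V) (L_lattice : is_lattice L) (L_dual : L `<=` dual_lattice b L)
  (n : nat) (n_gt0 : (1 <= n)%N) (n_le : (n <= p)%N)
  (h : n.-tuple V) (h_dual : forall i, dual_lattice b L (tnth h i))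
  (Gamma : set 'End(V))
  (Gamma_index : finite_index_subgroup Gamma (lattice_stabilizer b R L))
  (Gamma_neat : neat Gamma)
  (Gamma_disc : forall g x, Gamma g -> dual_lattice b L x -> L (g x - x))
  (V_isotropic : exists2 x : V, x != 0 & b x x = 0)
  (r : nat) (l : 'I_r.+1 -> {vspace V})
  (l_cusps : cusp_representatives b Gamma l)
  (beta : 'M[rat]_n) (beta_psd : pos_semidef beta)
  (beta_rank : \rank beta = n.-1)
  (j : 'I_r.+1) (U : {vspace V}) (U_span : cusp_spans b L h beta (l j) U) :
  let Gamma_j := Gamma `&` cusp_unipotent b (l j) in
  let Gamma_U := unipotent_fixing b (l j) U `&` Gamma_j in
  let Omega_j := Omega b beta (l j) in
  let Omega_ij := Omega_span b beta (l j) U in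
  [/\ finite_set (cusp_spans b L h beta (l j)),
      \dim U = n,
      group_action (@comp_lfun _ V V V) \1%VF Gamma_j Omega_j (@tuple_act V n),
      [/\ subgroup_GL Gamma_j, normal_subgroup Gamma_U Gamma_j
        & Gamma_U = [set g | Gamma_j g /\ {in U, forall x, g x = x}]]
    & exists act : set 'End(V) -> n.-tuple V -> n.-tuple V,
        [/\ forall g X, Gamma_j g -> Omega_ij X ->
              act (right_coset Gamma_U g) X = tuple_act g X,
            group_action (@coset_mul V) Gamma_U
              (left_quotient Gamma_U Gamma_j) Omega_ij act
          & free_action Gamma_U
              (left_quotient Gamma_U Gamma_j) Omega_ij act]].
Proof.
have l_iso : isotropic_line b (l j) by case: l_cusps.
case: (U_span) => X0 [OX0 _] X0U; move=> Gamma_j Gamma_U Omega_j Omega_ij.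
have NE := cusp_unipotentE b_nondeg b_sign l_iso.
have Gj_group : subgroup_GL Gamma_j.
  apply: subgroup_GLI; first by case: Gamma_index.
  by rewrite NE; exact: line_unipotent_subgroup.
have Gj_unip g : Gamma_j g -> line_unipotent b (l j) g by rewrite -NE; case.
have Oj_stab g X : Gamma_j g -> Omega_j X -> Omega_j (tuple_act g X).
  by move/Gj_unip => [[ig _] gl _]; apply: tuple_act_Omega => //; exact: limg_fixed.
have U_stab g x : Gamma_j g -> x \in U -> g x \in U.
  move/Gj_unip => [_ _ gp]; rewrite -X0U => xU; rewrite -[g x](subrK x) memvD //.
  apply: (subvP (Omega_sub_span OX0)); apply: gp.
  exact: (subvP (Omega_span_perp OX0)).
have Oij_span X : Omega_ij X -> <<X>>%VS = U by case.
have Oij_stab g X : Gamma_j g -> Omega_ij X -> Omega_ij (tuple_act g X).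
  move=> Gg [OX XU]; split; first exact: Oj_stab.
  (* Since [g] is injective, the image of [U] has the dimension of [U], and one inclusion
     suffices. *)
  rewrite -limg_span XU; apply/eqP; rewrite eqEdim limg_dim_eq ?leqnn ?andbT.
    by apply/subvP => _ /memv_imgP[x xU ->]; exact: U_stab.
  by case: Gj_group => /(_ g Gg) -> _ _ _; rewrite capv0.
have GUE : Gamma_U = [set g | Gamma_j g /\ {in U, forall x, g x = x}].
  apply/seteqP; split=> g; first by case=> [[_ gU] Gg].
  by case=> Gg gU; split=> //; split=> //; case: Gg.
split.
- exact: finite_cusp_spans b_sign l_iso L_lattice L_dual h_dual.
- by rewrite -X0U; apply: (Omega_dim_span OX0) => //; case: l_iso.
- split=> [//|X _|g k X _ _ _]; [exact: tuple_act1|exact: tuple_actM].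
- by split=> //; rewrite GUE; exact: normal_fixing.
- by rewrite GUE; exact: fixing_quotient_action.
Qed.
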